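(* Let $H$ be a finite-dimensional complex Hilbert space and let $(\mu,\eta,\delta,\epsilon)$ be a commutative Frobenius algebra on $H$. Then $$|\Psi\rangle=(1_H\otimes\delta)\circ\delta\circ\eta\in H\otimes H\otimes H$$ is a Frobenius state, with associated effects $\langle\Phi|=\epsilon\circ\mu:H\otimes H\to\mathbb C$ and $\langle\xi|=\epsilon:H\to\mathbb C$.
   Context: A commutative Frobenius algebra on $H$ consists of linear maps $\mu:H\otimes H\to H$, $\eta:\mathbb C\to H$, $\delta:H\to H\otimes H$, $\epsilon:H\to\mathbb C$ such that $(\mu,\eta)$ is a commutative monoid, $(\delta,\epsilon)$ is a cocommutative comonoid and $(1\otimes\mu)(\delta\otimes1)=\delta\mu=(\mu\otimes1)(1\otimes\delta)$. Vectors in $K$ are identified with linear maps $\mathbb C\to K$; an effect on $K$ is a linear functional $K\to\mathbb C$; normalisation of states is ignored. A symmetric vector $|\Psi\rangle\in H^{\otimes3}$ (invariant under permutations of the tensor factors) is a Frobenius state with associated effects $\langle\Phi|:H\otimes H\to\mathbb C$, $\langle\xi|:H\to\mathbb C$ if: (1) (strong SLOCC-maximality) with $|\beta\rangle=(\langle\xi|\otimes1\otimes1)|\Psi\rangle\in H\otimes H$, one has $(1_H\otimes\langle\Phi|)(|\beta\rangle\otimes1_H)=1_H$; (2) (strong symmetry) the vector $(1\otimes1\otimes\langle\Phi|\otimes1\otimes1)(|\Psi\rangle\otimes|\Psi\rangle)\in H^{\otimes4}$ is invariant under all permutations of the four tensor factors. *)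

(* Defs.v *)
From HB Require Import structures.
From mathcomp Require Import all_boot all_order all_algebra all_fingroup.

Set Implicit Arguments.
Unset Strict Implicit.
Unset Printing Implicit Defensive.

Import GRing.Theory.
Local Open Scope ring_scope.

Reserved Notation "U \ox V" (at level 40, left associativity).
Reserved Notation "u \ot v" (at level 40, left associativity).
Reserved Notation "f \oh g" (at level 40, left associativity).

(* For finite-dimensional spaces, U (x) V is realised as the space of linear  *)
(* maps from the dual of U to V, with u (x) v = (phi |-> phi u *: v).         *)
(* tens_liftE and tens_ext are the existence and uniqueness parts of its      *)
(* universal property.  Every structural map below is the linear map that     *)
(* the universal property provides; since tens_lift and linfun also accept    *)
(* functions that are not linear, the lemma in -E after each definition       *)
(* certifies its value on pure tensors.                                       *)

Definition tens (K : fieldType) (U V : vectType K) : vectType K :=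
  'Hom('Hom(U, K^o), V).
Notation "U \ox V" := (tens U V) : type_scope.

Definition tensv (K : fieldType) (U V : vectType K) (u : U) (v : V) :
    (U \ox V)%type :=
  linfun (fun phi : 'Hom(U, K^o) => (phi u : K) *: v).
Notation "u \ot v" := (tensv u v) : ring_scope.

Section UniversalProperty.
Variable K : fieldType.
Implicit Types U V W : vectType K.

Lemma linfunE U V (f : U -> V) : linear f -> linfun f =1 f.
Proof.
move=> lin_f; pose g := HB.pack_for {linear U -> V} f
  (GRing.isLinear.Build _ _ _ _ _ lin_f).
exact: (lfunE g).
Qed.

Lemma tensvE U V (u : U) (v : V) (phi : 'Hom(U, K^o)) :
  (u \ot v : 'Hom('Hom(U, K^o), V)) phi = (phi u : K) *: v.
Proof.
apply: linfunE => a f g.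
by rewrite add_lfunE scale_lfunE scalerDl scalerA.
Qed.

Lemma tensv_bilinear U V :
  bilinear_for *:%R *:%R (fun (u : U) (v : V) => u \ot v).
Proof.
split=> [v|u] a x y; apply/lfunP => phi.
  rewrite [RHS]add_lfunE scale_lfunE !tensvE linearP /=.
  by rewrite scalerDl scalerA.
rewrite [RHS]add_lfunE scale_lfunE !tensvE /=.
by rewrite scalerDr !scalerA mulrC.
Qed.

Definition tens_lift U V W (f : U -> V -> W) : 'Hom(U \ox V, W) :=
  linfun (fun t : 'Hom('Hom(U, K^o), V) =>
    \sum_(i < \dim {:U}) f (vbasis {:U})`_i (t (linfun (coord (vbasis {:U}) i : U -> K^o)))).

Lemma tens_liftE U V W (f : U -> V -> W) :
  bilinear_for *:%R *:%R f -> forall u v, tens_lift f (u \ot v) = f u v.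
Proof.
move=> [fl fr] u v; rewrite linfunE => [|a s t].
  pose g := HB.pack_for {linear U -> W} (f^~ v)
    (GRing.isLinear.Build _ _ _ _ _ (fl v)).
  have gE x : g x = f x v by [].
  rewrite -gE [in RHS](coord_vbasis (memvf u)) linear_sum.
  apply: eq_bigr => i _; rewrite linearZ gE tensvE linfunE.
    exact: (scalable_linear (fr _)).
  by move=> a x y; rewrite linearP.
rewrite scaler_sumr -big_split; apply: eq_bigr => i _ /=.
by rewrite add_lfunE scale_lfunE fr.
Qed.

Lemma tens_span U V (t : U \ox V) :
  t = \sum_(i < \dim {:U}) (vbasis {:U})`_i \ot
        (t : 'Hom('Hom(U, K^o), V)) (linfun (coord (vbasis {:U}) i : U -> K^o)).
Proof.
apply/lfunP => phi; rewrite sum_lfunE.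
have -> : phi = \sum_(i < \dim {:U}) (phi (vbasis {:U})`_i : K) *:
                  linfun (coord (vbasis {:U}) i : U -> K^o).
  apply/lfunP => u; rewrite [in LHS](coord_vbasis (memvf u)) linear_sum /=.
  rewrite sum_lfunE; apply: eq_bigr => i _.
  rewrite linearZ scale_lfunE linfunE /=; first by rewrite /GRing.scale /= mulrC.
  by move=> a x y; rewrite linearP.
rewrite linear_sum; apply: eq_bigr => i _ /=; rewrite tensvE linearZ /=.
congr (_ *: _); rewrite sum_lfunE (bigD1 i) //= big1 => [|j jNi].
  rewrite addr0 scale_lfunE linfunE => [|a x y]; last by rewrite linearP.
  by rewrite coord_free ?(basis_free (vbasisP _)) // eqxx /GRing.scale /= mulr1.
rewrite scale_lfunE linfunE => [|a x y]; last by rewrite linearP.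
rewrite coord_free ?(basis_free (vbasisP _)) // eq_sym (negPf jNi).
by rewrite scaler0.
Qed.

Lemma tens_ext U V W (f g : 'Hom(U \ox V, W)) :
  (forall u v, f (u \ot v) = g (u \ot v)) -> f = g.
Proof.
move=> fg; apply/lfunP => t; rewrite [t]tens_span !linear_sum.
by apply: eq_bigr => i _; apply: fg.
Qed.

End UniversalProperty.

Section StructuralMaps.
Variable K : fieldType.
Implicit Types U V W : vectType K.

Definition tens_map U V U' V' (f : 'Hom(U, U')) (g : 'Hom(V, V')) :
    'Hom(U \ox V, U' \ox V') :=
  tens_lift (fun u v => f u \ot g v).

Lemma tens_mapE U V U' V' (f : 'Hom(U, U')) (g : 'Hom(V, V')) u v :
  tens_map f g (u \ot v) = f u \ot g v.
Proof.
rewrite tens_liftE //; have [tl tr] := @tensv_bilinear K U' V'.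
by split=> [y|x] a p q /=; rewrite linearP ?tl ?tr.
Qed.

Definition tens_swap U V : 'Hom(U \ox V, V \ox U) :=
  tens_lift (fun u v => v \ot u).

Lemma tens_swapE U V (u : U) (v : V) : tens_swap U V (u \ot v) = v \ot u.
Proof.
rewrite tens_liftE //; have [tl tr] := @tensv_bilinear K V U.
by split=> [y|x] a p q /=; rewrite ?tl ?tr.
Qed.

Definition tens_assoc U V W : 'Hom((U \ox V) \ox W, U \ox (V \ox W)) :=
  tens_lift (fun t w => tens_lift (fun u v => u \ot (v \ot w)) t).

Lemma tens_assocE U V W (u : U) (v : V) (w : W) :
  tens_assoc U V W ((u \ot v) \ot w) = u \ot (v \ot w).
Proof.
have [tl tr] := @tensv_bilinear K U (V \ox W).
have [sl sr] := @tensv_bilinear K V W.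
have bil (w0 : W) : bilinear_for *:%R *:%R
    (fun (u : U) (v : V) => u \ot (v \ot w0)).
  by split=> [y|x] a p q /=; rewrite ?sl ?tl ?sr ?tr.
rewrite tens_liftE ?tens_liftE //; split=> [y|t] a p q /=; first exact: linearP.
rewrite [t]tens_span !linear_sum -big_split.
by apply: eq_bigr => i _ /=; rewrite !tens_liftE // sr tr.
Qed.

Definition tens_assocV U V W : 'Hom(U \ox (V \ox W), (U \ox V) \ox W) :=
  tens_lift (fun u t => tens_lift (fun v w => (u \ot v) \ot w) t).

Lemma tens_assocVE U V W (u : U) (v : V) (w : W) :
  tens_assocV U V W (u \ot (v \ot w)) = (u \ot v) \ot w.
Proof.
have [tl tr] := @tensv_bilinear K (U \ox V) W.
have [sl sr] := @tensv_bilinear K U V.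
have bil (u0 : U) : bilinear_for *:%R *:%R
    (fun (v : V) (w : W) => (u0 \ot v) \ot w).
  by split=> [y|x] a p q /=; rewrite ?sr ?sl ?tl ?tr.
rewrite tens_liftE ?tens_liftE //; split=> [t|x] a p q /=; last exact: linearP.
rewrite [t]tens_span !linear_sum -big_split.
by apply: eq_bigr => i _ /=; rewrite !tens_liftE // sl tl.
Qed.

Definition tens_lunit U : 'Hom(K^o \ox U, U) :=
  tens_lift (fun (c : K^o) u => (c : K) *: u).

Lemma tens_lunitE U (c : K^o) (u : U) :
  tens_lunit U (c \ot u) = (c : K) *: u.
Proof.
rewrite tens_liftE //; split=> [y|x] a p q /=; first by rewrite scalerDl scalerA.
by rewrite scalerDr !scalerA mulrC.
Qed.

Definition tens_lunitV U : 'Hom(U, K^o \ox U) :=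
  linfun (fun u => (1 : K^o) \ot u).

Lemma tens_lunitVE U (u : U) : tens_lunitV U u = (1 : K^o) \ot u.
Proof. by apply: linfunE; apply: (@tensv_bilinear K K^o U).2. Qed.

Definition tens_runit U : 'Hom(U \ox K^o, U) :=
  tens_lift (fun u (c : K^o) => (c : K) *: u).

Lemma tens_runitE U (u : U) (c : K^o) :
  tens_runit U (u \ot c) = (c : K) *: u.
Proof.
rewrite tens_liftE //; split=> [y|x] a p q /=; last by rewrite scalerDl scalerA.
by rewrite scalerDr !scalerA mulrC.
Qed.

Definition tens_runitV U : 'Hom(U, U \ox K^o) :=
  linfun (fun u => u \ot (1 : K^o)).

Lemma tens_runitVE U (u : U) : tens_runitV U u = u \ot (1 : K^o).
Proof.
apply: (@linfunE K U (U \ox K^o) (fun u => u \ot (1 : K^o))).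
exact: (@tensv_bilinear K U K^o).1.
Qed.

End StructuralMaps.

Notation "f \oh g" := (tens_map f g) : ring_scope.

(* tens_pow H k has k.+1 tensor factors: H (x) (H (x) ( ... (x) H)).          *)
Section TensorPower.
Variables (K : fieldType) (H : vectType K).

Fixpoint tens_pow (k : nat) : vectType K :=
  if k is k'.+1 then tens H (tens_pow k') else H.

Fixpoint tens_prod (k : nat) : {ffun 'I_k.+1 -> H} -> tens_pow k :=
  if k is k'.+1 then fun u => u ord0 \ot tens_prod [ffun j => u (lift ord0 j)]
  else fun u => u ord0.

Definition ffun_cons (k : nat) (x : H) (u : {ffun 'I_k -> H}) :
    {ffun 'I_k.+1 -> H} :=
  [ffun i => if unlift ord0 i is Some j then u j else x].

Fixpoint tens_mlift (W : vectType K) (k : nat) :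
    ({ffun 'I_k.+1 -> H} -> W) -> 'Hom(tens_pow k, W) :=
  if k is k'.+1 then fun f =>
    tens_lift (fun x t => tens_mlift (fun u => f (ffun_cons x u)) t)
  else fun f => linfun (fun x : H => f [ffun=> x]).

Definition tens_perm (k : nat) (s : 'S_k.+1) : 'Hom(tens_pow k, tens_pow k) :=
  tens_mlift (fun u => tens_prod [ffun i => u (s i)]).

Definition ffun_set (k : nat) (u : {ffun 'I_k -> H}) (i : 'I_k) (x : H) :
    {ffun 'I_k -> H} :=
  [ffun j => if j == i then x else u j].

Lemma ffun_setE k (u : {ffun 'I_k -> H}) i x j :
  ffun_set u i x j = if j == i then x else u j.
Proof. by rewrite /ffun_set ffunE. Qed.

Lemma ffun_consE k (x : H) (u : {ffun 'I_k -> H}) i :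
  ffun_cons x u i = if unlift ord0 i is Some j then u j else x.
Proof. by rewrite /ffun_cons ffunE. Qed.

Lemma ffun_cons_set k (x : H) (u : {ffun 'I_k -> H}) :
  ffun_cons x u = ffun_set (ffun_cons 0 u) ord0 x.
Proof.
apply/ffunP => j; rewrite !(ffun_setE, ffun_consE).
by case: (unliftP ord0 j) => [j' ->|->].
Qed.

Definition multilinear (W : vectType K) (k : nat) (f : {ffun 'I_k -> H} -> W) :=
  forall (u : {ffun 'I_k -> H}) (i : 'I_k), linear (fun x => f (ffun_set u i x)).

Lemma tens_prod_multilinear k : multilinear (@tens_prod k).
Proof.
elim: k => [|k IHk] u i a x y /=.
  by rewrite !(ffun_setE, ffun_consE, ffunE) [i]ord1 eqxx.
have [tl tr] := @tensv_bilinear K H (tens_pow k).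
case: (unliftP ord0 i) => [j ->|->]; rewrite !(ffun_setE, ffun_consE, ffunE).
  have E z : [ffun j0 => ffun_set u (lift ord0 j) z (lift ord0 j0)] =
             ffun_set [ffun j0 => u (lift ord0 j0)] j z.
    by apply/ffunP => j'; rewrite !(ffun_setE, ffun_consE, ffunE) (inj_eq lift_inj).
  by rewrite !E IHk tr.
have E z : [ffun j0 => ffun_set u ord0 z (lift ord0 j0)] =
           [ffun j0 => u (lift ord0 j0)].
  by apply/ffunP => j'; rewrite !(ffun_setE, ffun_consE, ffunE).
by rewrite !E eqxx tl.
Qed.

Lemma multilinear_cons (W : vectType K) k (f : {ffun 'I_k.+1 -> H} -> W) x :
  multilinear f -> multilinear (fun u => f (ffun_cons x u)).
Proof.
move=> fM u i a y z /=.
have E w : ffun_cons x (ffun_set u i w) =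
           ffun_set (ffun_cons x u) (lift ord0 i) w.
  apply/ffunP => j; rewrite !(ffun_setE, ffun_consE, ffunE).
  case: (unliftP ord0 j) => [j' ->|->]; last by rewrite (negPf (neq_lift _ _)).
  by rewrite ffun_setE (inj_eq lift_inj).
by rewrite !E fM.
Qed.

Lemma multilinear1 (W : vectType K) (f : {ffun 'I_1 -> H} -> W) :
  multilinear f -> linear (fun x => f [ffun=> x]).
Proof.
move=> fM a x y; have := fM [ffun=> 0] ord0 a x y.
have E z : ffun_set [ffun=> 0] ord0 z = [ffun=> z] :> {ffun 'I_1 -> H}.
  by apply/ffunP => j; rewrite !(ffun_setE, ffunE) [j]ord1 eqxx.
by rewrite !E.
Qed.

Lemma tens_mliftD (W : vectType K) k (f g h : {ffun 'I_k.+1 -> H} -> W) a :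
  multilinear f -> multilinear g -> multilinear h ->
  (forall u, h u = a *: f u + g u) ->
  tens_mlift h = a *: tens_mlift f + tens_mlift g.
Proof.
elim: k a f g h => [|k IHk] a f g h fM gM hM hE.
  by apply/lfunP => x; rewrite add_lfunE scale_lfunE /= !linfunE //; apply: multilinear1.
have bil (p : {ffun 'I_k.+2 -> H} -> W) : multilinear p ->
    bilinear_for *:%R *:%R
      (fun x t => tens_mlift (fun u => p (ffun_cons x u)) t).
  move=> pM; split=> [t|x] b y z /=; last exact: linearP.
  rewrite -scale_lfunE -add_lfunE; congr (fun_of_lfun _ t).
  apply: (IHk b) => [|||u].
  1-3: exact: multilinear_cons.
  by rewrite (ffun_cons_set (b *: y + z)) (ffun_cons_set y) (ffun_cons_set z) pM.
apply: tens_ext => x t; rewrite add_lfunE scale_lfunE /=.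
rewrite !tens_liftE; [|exact: bil..].
rewrite -scale_lfunE -add_lfunE; congr (fun_of_lfun _ t).
by apply: IHk => [|||u]; [exact: multilinear_cons.. | exact: hE].
Qed.

Lemma tens_mliftE (W : vectType K) k (f : {ffun 'I_k.+1 -> H} -> W) u :
  multilinear f -> tens_mlift f (tens_prod u) = f u.
Proof.
elim: k f u => [|k IHk] f u fM /=.
  rewrite linfunE; last exact: multilinear1.
  by congr f; apply/ffunP => j; rewrite ffunE [j]ord1.
rewrite tens_liftE.
  rewrite IHk; last exact: multilinear_cons.
  congr f; apply/ffunP => j; rewrite ffunE.
  by case: (unliftP ord0 j) => [j' ->|->]; rewrite ?ffunE.
split=> [t|x] b y z /=; last exact: linearP.
rewrite -scale_lfunE -add_lfunE; congr (fun_of_lfun _ t).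
apply: (@tens_mliftD W k _ _ _ b) => [|||v].
1-3: exact: multilinear_cons.
by rewrite (ffun_cons_set (b *: y + z)) (ffun_cons_set y) (ffun_cons_set z) fM.
Qed.

Lemma tens_permE k (s : 'S_k.+1) (u : {ffun 'I_k.+1 -> H}) :
  tens_perm s (tens_prod u) = tens_prod [ffun i => u (s i)].
Proof.
apply: tens_mliftE => v i a x y /=.
have E z : [ffun j => ffun_set v i z (s j)] =
           ffun_set [ffun j => v (s j)] ((s^-1)%g i) z.
  by apply/ffunP => j; rewrite !(ffun_setE, ffunE) (can2_eq (permK s) (permKV s)).
by rewrite !E tens_prod_multilinear.
Qed.

End TensorPower.

Section Frobenius.
Variables (K : fieldType) (H : vectType K).
Local Open Scope lfun_scope.

Record comm_monoid (mu : 'Hom(H \ox H, H)) (eta : 'Hom(K^o, H)) : Prop :=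
  CommMonoid {
    mu_assoc : mu \o (mu \oh \1) = mu \o (\1 \oh mu) \o tens_assoc H H H;
    mu_unitl : mu \o (eta \oh \1) \o tens_lunitV H = \1;
    mu_unitr : mu \o (\1 \oh eta) \o tens_runitV H = \1;
    mu_comm : mu \o tens_swap H H = mu }.

Record cocomm_comonoid (delta : 'Hom(H, H \ox H)) (eps : 'Hom(H, K^o)) : Prop :=
  CocommComonoid {
    delta_coassoc :
      tens_assoc H H H \o (delta \oh \1) \o delta = (\1 \oh delta) \o delta;
    delta_counitl : tens_lunit H \o (eps \oh \1) \o delta = \1;
    delta_counitr : tens_runit H \o (\1 \oh eps) \o delta = \1;
    delta_cocomm : tens_swap H H \o delta = delta }.

Record comm_frobenius_algebra (mu : 'Hom(H \ox H, H)) (eta : 'Hom(K^o, H))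
    (delta : 'Hom(H, H \ox H)) (eps : 'Hom(H, K^o)) : Prop :=
  CommFrobeniusAlgebra {
    frobenius_monoid : comm_monoid mu eta;
    frobenius_comonoid : cocomm_comonoid delta eps;
    frobenius_lawl :
      (\1 \oh mu) \o tens_assoc H H H \o (delta \oh \1) = delta \o mu;
    frobenius_lawr :
      (mu \oh \1) \o tens_assocV H H H \o (\1 \oh delta) = delta \o mu }.

(* A vector of T is given as a linear map K^o -> T, an effect on T as a       *)
(* linear map T -> K^o.                                                       *)
Definition symmetric_vector (k : nat) (Psi : 'Hom(K^o, tens_pow H k)) : Prop :=
  forall s : 'S_k.+1, tens_perm H s \o Psi = Psi.

Definition cap3 (xi : 'Hom(H, K^o)) (Psi : 'Hom(K^o, H \ox (H \ox H))) :
    'Hom(K^o, H \ox H) :=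
  tens_lunit (H \ox H) \o (xi \oh (\1 : 'End(H \ox H))) \o Psi.

Definition snake (Phi : 'Hom(H \ox H, K^o)) (beta : 'Hom(K^o, H \ox H)) :
    'End(H) :=
  tens_runit H \o ((\1 : 'End(H)) \oh Phi) \o tens_assoc H H H
    \o (beta \oh (\1 : 'End(H))) \o tens_lunitV H.

(* 1 (x) 1 (x) Phi (x) 1 (x) 1, up to rebracketing; see contract33E.          *)
Definition contract33 (Phi : 'Hom(H \ox H, K^o)) :
    'Hom((H \ox (H \ox H)) \ox (H \ox (H \ox H)), H \ox (H \ox (H \ox H))) :=
  let H2 := tens H H in let H3 := tens H H2 in
  ((\1 : 'End(H)) \oh
    (((\1 : 'End(H)) \oh
      (tens_lunit H2 \o (Phi \oh (\1 : 'End(H2))) \o tens_assocV H H H2))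
     \o tens_assoc H H H3))
  \o tens_assoc H H2 H3.

Lemma contract33E (Phi : 'Hom(H \ox H, K^o)) (a b c d e f : H) :
  contract33 Phi ((a \ot (b \ot c)) \ot (d \ot (e \ot f))) =
  (Phi (c \ot d) : K) *: (a \ot (b \ot (e \ot f))).
Proof.
rewrite /contract33 !comp_lfunE tens_assocE tens_mapE comp_lfunE tens_assocE.
rewrite tens_mapE !comp_lfunE tens_assocVE tens_mapE tens_lunitE !id_lfunE.
rewrite (scalable_linear ((@tensv_bilinear K H (H \ox H)).2 b)).
by rewrite (scalable_linear ((@tensv_bilinear K H (H \ox (H \ox H))).2 a)).
Qed.

Record frobenius_state (Psi : 'Hom(K^o, H \ox (H \ox H)))
    (Phi : 'Hom(H \ox H, K^o)) (xi : 'Hom(H, K^o)) : Prop := FrobeniusState {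
  frobenius_state_symmetric : symmetric_vector (k := 2) Psi;
  strong_SLOCC_maximality : snake Phi (cap3 xi Psi) = \1;
  strong_symmetry :
    symmetric_vector (k := 3) (contract33 Phi \o (Psi \oh Psi) \o tens_lunitV K^o) }.

End Frobenius.

(* Main.v *)
Require Import Defs.
From HB Require Import structures.
From mathcomp Require Import all_boot all_order all_algebra all_fingroup.
From mathcomp Require Import reals complex.

(* Write delta_k : H -> H^(k+1) for the iterated comultiplication.            *)
(* Coassociativity and cocommutativity make delta_k invariant under the       *)
(* transposition of the first two factors and, by induction, under the        *)
(* permutations fixing the first factor; these generate the symmetric group.  *)
(* As Psi = delta_2 eta, this is the symmetry of Psi.  The Frobenius law and  *)
(* the counit law give (Phi (x) 1)(c (x) delta eta) = c, i.e., Phi and        *)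
(* delta eta are inverse to each other: this is SLOCC-maximality, and it      *)
(* contracts Psi (x) Psi to delta_3 eta, which is symmetric.                  *)

Set Implicit Arguments.
Unset Strict Implicit.
Unset Printing Implicit Defensive.

Import GRing.Theory.
Local Open Scope ring_scope.

(** The proof rests on two facts about the diagrams. Iterated copies are symmetric
    ([iter_delta_sym]): by [perm_lift_tperm_ind] it suffices to treat permutations fixing the first
    factor, which is the induction hypothesis, and one transposition, which coassociativity brings
    next to a [delta] and cocommutativity absorbs. Contracting with [delta] of the unit is the
    identity on either side ([contract_unit_copyl], [contract_unit_copyr]). So all three conditions
    reduce to statements about copies of the unit, via [cap3_unit_copy] and [contract33_unit_copy].
    Equalities of diagrams are checked on pure tensors. *)

Section TensorCalculus.
Variable K : fieldType.
Implicit Types U V W X : vectType K.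

Lemma tensv_suml U V I (r : seq I) (u : I -> U) (v : V) :
  (\sum_(i <- r) u i) \ot v = \sum_(i <- r) u i \ot v.
Proof.
pose g := HB.pack_for {linear U -> tens U V} (fun u => u \ot v)
  (GRing.isLinear.Build _ _ _ _ _ ((@tensv_bilinear K U V).1 v)).
exact: (linear_sum g).
Qed.

Lemma tensv_sumr U V I (r : seq I) (u : U) (v : I -> V) :
  u \ot (\sum_(i <- r) v i) = \sum_(i <- r) u \ot v i.
Proof.
pose g := HB.pack_for {linear V -> tens U V} (fun v => u \ot v)
  (GRing.isLinear.Build _ _ _ _ _ ((@tensv_bilinear K U V).2 u)).
exact: (linear_sum g).
Qed.

Lemma tens_ext3r U V W X (f g : 'Hom(U \ox (V \ox W), X)) :
  (forall u v w, f (u \ot (v \ot w)) = g (u \ot (v \ot w))) -> f = g.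
Proof.
move=> fg; apply: tens_ext => u t; rewrite [t]tens_span tensv_sumr !linear_sum.
by apply: eq_bigr => i _; apply: fg.
Qed.

Lemma tens_ext3l U V W X (f g : 'Hom((U \ox V) \ox W, X)) :
  (forall u v w, f ((u \ot v) \ot w) = g ((u \ot v) \ot w)) -> f = g.
Proof.
move=> fg; apply: tens_ext => t w; rewrite [t]tens_span tensv_suml !linear_sum.
by apply: eq_bigr => i _; apply: fg.
Qed.

Lemma lfun_scalar_ext V (f g : 'Hom(K^o, V)) : f 1 = g 1 -> f = g.
Proof.
move=> fg; apply/lfunP => c.
have -> : c = (c : K) *: (1 : K^o) by rewrite /GRing.scale /= mulr1.
by rewrite !linearZ; congr (_ *: _).
Qed.

Lemma tens_map_comp U U' U'' V V' V'' (f' : 'Hom(U', U'')) (f : 'Hom(U, U'))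
    (g' : 'Hom(V', V'')) (g : 'Hom(V, V')) :
  ((f' \o f) \oh (g' \o g))%VF = ((f' \oh g') \o (f \oh g))%VF.
Proof.
by apply: tens_ext => u v; rewrite !(comp_lfunE, tens_mapE).
Qed.

Lemma tens_map_id U V : (\1%VF : 'End(U)) \oh (\1%VF : 'End(V)) = \1%VF.
Proof. by apply: tens_ext => u v; rewrite tens_mapE !id_lfunE. Qed.

Lemma tens_lunit_map U V W (f : 'Hom(V, W)) (g : 'Hom(U, K^o)) :
  (tens_lunit W \o (g \oh \1) \o (\1 \oh f) =
   f \o tens_lunit V \o (g \oh \1))%VF.
Proof.
apply: tens_ext => u v.
by rewrite !comp_lfunE !tens_mapE !tens_lunitE !id_lfunE linearZ.
Qed.

Lemma tens_prod_ext (H X : vectType K) k (f g : 'Hom(tens_pow H k, X)) :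
  (forall u, f (tens_prod u) = g (tens_prod u)) -> f = g.
Proof.
elim: k X f g => [|k IHk] X f g fg.
  by apply/lfunP => x; have := fg [ffun=> x]; rewrite /= ffunE.
apply: tens_ext => x t.
(* Freezing the first factor leaves a linear map on the smaller power, to which the induction
   hypothesis applies. *)
pose at_x (h : 'Hom(tens_pow H k.+1, X)) : 'Hom(tens_pow H k, X) :=
  linfun (fun t => h (x \ot t)).
have at_xE h s : at_x h s = h (x \ot s).
  by apply: linfunE => a y z; rewrite (tensv_bilinear _ _).2 linearP.
rewrite -!at_xE; congr (fun_of_lfun _ t); apply: IHk => u.
rewrite !at_xE; have := fg (ffun_cons x u); rewrite /= ffun_consE unlift_none.
suff -> : [ffun j => ffun_cons x u (lift ord0 j)] = u by [].
by apply/ffunP => j; rewrite ffunE ffun_consE liftK.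
Qed.

End TensorCalculus.

(** * Permutations of tensor factors and the symmetry of iterated comultiplication *)

Section PermutationAction.
Variables (K : fieldType) (H : vectType K).
Local Open Scope lfun_scope.

(** Permuting factors is precomposition of the index, and [(s * t) i] is [t (s i)]; hence no
    inversion or reversal of order occurs. *)
Lemma tens_permM k (s t : 'S_k.+1) :
  tens_perm H (s * t)%g = tens_perm H s \o tens_perm H t.
Proof.
apply: tens_prod_ext => u; rewrite comp_lfunE !tens_permE.
by congr tens_prod; apply/ffunP => i; rewrite !ffunE permM.
Qed.

Lemma tens_perm1 k : tens_perm H (1%g : 'S_k.+1) = \1.
Proof.
apply: tens_prod_ext => u; rewrite id_lfunE tens_permE.
by congr tens_prod; apply/ffunP => i; rewrite !ffunE perm1.
Qed.

Lemma tens_perm_lift k (s : 'S_k.+1) :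
  tens_perm H (lift_perm ord0 ord0 s) = (\1 : 'End(H)) \oh tens_perm H s.
Proof.
apply: (@tens_prod_ext K H _ k.+1) => u.
rewrite tens_permE /= tens_mapE id_lfunE tens_permE ffunE lift_perm_id.
by congr (_ \ot tens_prod _); apply/ffunP => i; rewrite !ffunE lift_perm_lift.
Qed.

Lemma lift_ord0_neq0 k (j : 'I_k.+1) : lift ord0 j != ord0 :> 'I_k.+2.
Proof. by rewrite eq_sym neq_lift. Qed.

Lemma tens_perm_tperm1 :
  tens_perm H (tperm ord0 (lift ord0 ord0) : 'S_2) = tens_swap H H.
Proof.
apply: (@tens_prod_ext K H _ 1) => u.
rewrite tens_permE /= tens_swapE !ffunE tpermL.
by rewrite tpermR.
Qed.

(** Since [t] need not be a pure tensor, [tens_permE] does not apply directly; the permutation is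
    first identified with the swap conjugated by associators. *)
Lemma tens_perm_tperm k (x y : H) (t : tens_pow H k) :
  tens_perm H (tperm ord0 (lift ord0 ord0) : 'S_k.+3) (x \ot (y \ot t)) =
  y \ot (x \ot t).
Proof.
pose T := tens_pow H k.
have E : tens_perm H (tperm ord0 (lift ord0 ord0) : 'S_k.+3) =
    tens_assoc H H T \o (tens_swap H H \oh \1) \o tens_assocV H H T.
  apply: (@tens_prod_ext K H _ k.+2) => u; rewrite tens_permE /=.
  rewrite !comp_lfunE tens_assocVE tens_mapE tens_swapE tens_assocE !ffunE.
  rewrite tpermL tpermR id_lfunE; congr (_ \ot (_ \ot tens_prod _)).
  by apply/ffunP => i; rewrite !ffunE tpermD.
by rewrite E !comp_lfunE tens_assocVE tens_mapE tens_swapE tens_assocE id_lfunE.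
Qed.

(* A permutation moving 0 to j is brought back to one fixing 0 by first sending *)
(* j to 1 with a lifted permutation and then exchanging 0 and 1.                *)
Lemma perm_lift_tperm_ind k (P : 'S_k.+2 -> Prop) :
    (forall s, P (lift_perm ord0 ord0 s)) -> P (tperm ord0 (lift ord0 ord0)) ->
    (forall s t, P s -> P t -> P (s * t)%g) ->
  forall s, P s.
Proof.
move=> Plift Ptperm PM s.
have Pfix (t : 'S_k.+2) : t ord0 = ord0 -> P t.
  (* The default [ord0] is never reached: [t] is injective and fixes 0, so it sends no other index
     to 0. *)
  move=> t0; pose f i := odflt ord0 (unlift ord0 (t (lift ord0 i))).
  have fE i : lift ord0 (f i) = t (lift ord0 i).
    rewrite /f; case: unliftP => [j -> //|].
    by rewrite -[in RHS]t0 => /perm_inj /eqP; rewrite (negPf (lift_ord0_neq0 i)).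
  have f_inj : injective f.
    by move=> i j eq_f; apply/(@lift_inj _ ord0)/(@perm_inj _ t); rewrite -!fE eq_f.
  suff -> : t = lift_perm ord0 ord0 (perm f_inj) by [].
  apply/permP => i; case: (unliftP ord0 i) => [j ->|->].
    by rewrite lift_perm_lift permE fE.
  by rewrite lift_perm_id.
case: (unliftP ord0 (s ord0)) => [j s0|/Pfix //].
pose a := lift_perm ord0 ord0 (tperm j ord0).
pose b : 'S_k.+2 := tperm ord0 (lift ord0 ord0).
have -> : s = (s * a * b * (b^-1 * a^-1))%g.
  by rewrite -!mulgA (mulgA b) mulgV mul1g mulgV mulg1.
apply: (PM); first by apply: Pfix; rewrite !permM s0 lift_perm_lift tpermL tpermR.
by rewrite tpermV lift_permV; apply: PM.
Qed.

Fixpoint iter_delta (delta : 'Hom(H, H \ox H)) k : 'Hom(H, tens_pow H k) :=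
  if k is k'.+1 then (\1 \oh iter_delta delta k') \o delta else \1.

Lemma iter_delta_sym delta eps : cocomm_comonoid delta eps ->
  forall k (s : 'S_k.+1), tens_perm H s \o iter_delta delta k = iter_delta delta k.
Proof.
case=> coassoc _ _ cocomm; elim=> [|k IHk] s.
  suff -> : s = 1%g by rewrite tens_perm1 comp_lfun1l.
  by apply/permP => i; rewrite [LHS]ord1 [RHS]ord1.
move: s; apply: perm_lift_tperm_ind => [s||s t Ps Pt].
- by rewrite tens_perm_lift /= comp_lfunA -tens_map_comp IHk comp_lfun1l.
- case: k {IHk} => [|k] /=.
    by rewrite tens_map_id comp_lfun1l tens_perm_tperm1.
  set b := tperm _ _; set d := iter_delta delta k; pose T := tens_pow H k.
  have <- : (\1 : 'End(H)) \oh ((\1 : 'End(H)) \oh d) \o (\1 \oh delta) =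
      \1 \oh (\1 \oh d \o delta) by rewrite -tens_map_comp comp_lfun1l.
  rewrite -comp_lfunA -coassoc !comp_lfunA; congr (_ \o delta).
  (* Coassociativity has placed a [delta] on the first two factors; cocommutativity now supplies a
     swap that cancels [b]. *)
  rewrite -[in LHS]cocomm.
  have -> : (tens_swap H H \o delta) \oh (\1 : 'End(H)) =
      (tens_swap H H \oh \1) \o (delta \oh \1).
    by rewrite -tens_map_comp comp_lfun1l.
  rewrite !comp_lfunA; congr (_ \o _).
  apply: tens_ext3l => x y z.
  rewrite !comp_lfunE tens_mapE tens_swapE !tens_assocE !tens_mapE !id_lfunE.
  exact: tens_perm_tperm.
- by rewrite tens_permM -comp_lfunA Pt Ps.
Qed.

End PermutationAction.

(** * Contractions with copies of the unit, and the Frobenius state *)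

Section FrobeniusState.
Variables (K : fieldType) (H : vectType K).
Local Open Scope lfun_scope.

(** The contraction touches only the third factor of [t], so [t] may be entangled. *)
Lemma contract33_factor (Phi : 'Hom(H \ox H, K^o))
    (Psi : 'Hom(K^o, H \ox (H \ox H))) (f : 'Hom(H, H \ox H)) :
    (forall c, tens_lunit (H \ox H) ((Phi \oh \1)
      (tens_assocV H H (H \ox H) (c \ot Psi 1))) = f c) ->
  forall t, contract33 Phi (t \ot Psi 1) = (\1 \oh (\1 \oh f)) t.
Proof.
move=> contract t.
have <- : contract33 Phi \o ((\1 \oh Psi) \o tens_runitV (H \ox (H \ox H))) =
    \1 \oh (\1 \oh f).
  apply: tens_ext3r => a b c.
  rewrite /contract33 !comp_lfunE tens_runitVE tens_mapE id_lfunE tens_assocE.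
  rewrite tens_mapE comp_lfunE tens_assocE tens_mapE !comp_lfunE !id_lfunE.
  by rewrite contract !tens_mapE !id_lfunE.
move: (contract33 Phi) => C.
by rewrite !comp_lfunE tens_runitVE tens_mapE id_lfunE.
Qed.

Variables (mu : 'Hom(H \ox H, H)) (eta : 'Hom(K^o, H)).
Variables (delta : 'Hom(H, H \ox H)) (eps : 'Hom(H, K^o)).
Hypothesis frob : comm_frobenius_algebra mu eta delta eps.

Lemma frob_mul1x x : mu (eta 1 \ot x) = x.
Proof.
have /lfunP/(_ x) := mu_unitl (frobenius_monoid frob).
by rewrite !comp_lfunE tens_lunitVE tens_mapE !id_lfunE.
Qed.

Lemma frob_mulx1 x : mu (x \ot eta 1) = x.
Proof.
have /lfunP/(_ x) := mu_unitr (frobenius_monoid frob).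
by rewrite !comp_lfunE tens_runitVE tens_mapE !id_lfunE.
Qed.

Lemma frob_counitl x : tens_lunit H ((eps \oh \1) (delta x)) = x.
Proof.
have /lfunP/(_ x) := delta_counitl (frobenius_comonoid frob).
by rewrite !comp_lfunE !id_lfunE.
Qed.

Lemma frob_counitr x : tens_runit H ((\1 \oh eps) (delta x)) = x.
Proof.
have /lfunP/(_ x) := delta_counitr (frobenius_comonoid frob).
by rewrite !comp_lfunE !id_lfunE.
Qed.

(** The Frobenius law turns the left side into [delta] of the product of the unit with [x], with
    [eps] on one leg; the unit and counit laws finish. This is a snake equation. *)
Lemma contract_unit_copyl (x : H) :
  tens_runit H ((\1 \oh (eps \o mu)) (tens_assoc H H H (delta (eta 1) \ot x))) = x.
Proof.
have -> : (\1 : 'End(H)) \oh (eps \o mu) = (\1 \oh eps) \o (\1 \oh mu).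
  by rewrite -tens_map_comp comp_lfun1l.
have /lfunP/(_ (eta 1 \ot x)) := frobenius_lawl frob.
rewrite !comp_lfunE tens_mapE id_lfunE frob_mul1x => ->; exact: frob_counitr.
Qed.

Lemma contract_unit_copyr (x : H) :
  tens_lunit H (((eps \o mu) \oh \1) (tens_assocV H H H (x \ot delta (eta 1)))) = x.
Proof.
have -> : (eps \o mu) \oh (\1 : 'End(H)) = (eps \oh \1) \o (mu \oh \1).
  by rewrite -tens_map_comp comp_lfun1l.
have /lfunP/(_ (x \ot eta 1)) := frobenius_lawr frob.
rewrite !comp_lfunE tens_mapE id_lfunE frob_mulx1 => ->; exact: frob_counitl.
Qed.

Let Psi := (\1 \oh delta) \o delta \o eta.
Let Phi := eps \o mu.

Lemma cap3_unit_copy : cap3 eps Psi = delta \o eta.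
Proof.
rewrite /cap3 /Psi !comp_lfunA tens_lunit_map; apply/lfunP => c.
by rewrite !comp_lfunE frob_counitl.
Qed.

Lemma contract33_unit_copy :
  contract33 Phi \o (Psi \oh Psi) \o tens_lunitV K^o = iter_delta delta 3 \o eta.
Proof.
(* The outer [delta] of [Psi] acts on a leg that [Phi] does not meet, so it slides past the
   contraction. *)
have slide : tens_lunit (H \ox H) \o (Phi \oh \1) \o tens_assocV H H (H \ox H)
      \o (\1 \oh (\1 \oh delta)) =
    delta \o tens_lunit H \o (Phi \oh \1) \o tens_assocV H H H.
  apply: tens_ext3r => x y z.
  rewrite !comp_lfunE !(tens_mapE, tens_assocVE) !tens_lunitE !id_lfunE.
  by rewrite linearZ.
have contract c : tens_lunit (H \ox H) ((Phi \oh \1)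
    (tens_assocV H H (H \ox H) (c \ot Psi 1))) = delta c.
  have /lfunP/(_ (c \ot delta (eta 1))) := slide.
  by rewrite !comp_lfunE tens_mapE id_lfunE contract_unit_copyr.
have contractPsi := contract33_factor contract.
move: (contract33 Phi) contractPsi => C contractPsi. (* otherwise comp_lfunE unfolds contract33 *)
apply: lfun_scalar_ext; rewrite 2![LHS]comp_lfunE.
rewrite tens_lunitVE tens_mapE contractPsi.
have -> : iter_delta delta 3 = (\1 \oh (\1 \oh delta)) \o (\1 \oh delta) \o delta.
  by rewrite /= tens_map_id comp_lfun1l -tens_map_comp comp_lfun1l.
by rewrite /Psi !comp_lfunE.
Qed.

Lemma frobenius_algebra_state : frobenius_state Psi Phi eps.
Proof.
have sym := iter_delta_sym (frobenius_comonoid frob).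
split=> [s||s].
- have := sym 2 s; rewrite /= tens_map_id comp_lfun1l => E.
  by rewrite /Psi comp_lfunA E.
- apply/lfunP => x; rewrite /snake cap3_unit_copy !comp_lfunE tens_lunitVE.
  by rewrite tens_mapE comp_lfunE !id_lfunE contract_unit_copyl.
- by rewrite contract33_unit_copy comp_lfunA sym.
Qed.

End FrobeniusState.

Theorem theorem8p3p2 (R : realType) (H : vectType R[i])
  (ip : {dot H for (@Num.conj R[i])})
  (mu : 'Hom(H \ox H, H)) (eta : 'Hom((R[i])^o, H))
  (delta : 'Hom(H, H \ox H)) (eps : 'Hom(H, (R[i])^o)) :
  comm_frobenius_algebra mu eta delta eps ->
  frobenius_state ((\1 \oh delta) \o delta \o eta)%VF (eps \o mu)%VF eps.
Proof. exact: frobenius_algebra_state. Qed.
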